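(* Let $\Theta\in\mathbb{R}^{p\times p}$ and $\Psi\in\mathbb{R}^{q\times q}$ be symmetric matrices such that $\Omega=\Theta\oplus\Psi$ is positive definite, and assume that the trace ratio of $\Psi$ to $\Theta$ is given as $\rho=\frac{\operatorname{tr}(\Psi)}{\operatorname{tr}(\Theta)}$ (with $\operatorname{tr}(\Theta)\neq 0$). Then $\Omega$ can be mapped to a unique pair of symmetric matrices $(\Theta,\Psi)$; that is, $(\Theta,\Psi)$ is the only pair of symmetric matrices (of sizes $p\times p$ and $q\times q$) with $\Theta\oplus\Psi=\Omega$ and $\operatorname{tr}(\Psi)/\operatorname{tr}(\Theta)=\rho$. Moreover, the diagonals of $\Theta$ and $\Psi$ are identified as $$\operatorname{diag}(\Theta)=\frac1q\left[\operatorname{diag}\left(\sum_{i=1}^q (I_p\otimes e_{q,i})^T\,\Omega\,(I_p\otimes e_{q,i})\right)-\frac{\rho}{q+\rho p}\operatorname{tr}(\Omega)\,I_p\right],$$ $$\operatorname{diag}(\Psi)=\frac1p\left[\operatorname{diag}\left(\sum_{j=1}^p (e_{p,j}\otimes I_q)^T\,\Omega\,(e_{p,j}\otimes I_q)\right)-\frac{1}{q+\rho p}\operatorname{tr}(\Omega)\,I_q\right].$$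
   Context: $p,q\ge 1$ are integers. $I_a$ is the $a\times a$ identity matrix, $\otimes$ is the Kronecker product, and the Kronecker sum is $\Theta\oplus\Psi=\Theta\otimes I_q+I_p\otimes\Psi\in\mathbb{R}^{pq\times pq}$. $e_{a,i}$ is the $a\times 1$ one-hot vector with a $1$ at entry $i$ and $0$ elsewhere. For a square matrix $A$, $\operatorname{diag}(A)$ denotes the diagonal matrix having the same diagonal as $A$. *)

(* Defs.v *)
From HB Require Import structures.
From mathcomp Require Import all_boot all_order all_algebra.
From mathcomp Require Import sesquilinear reals mxtens.

Set Implicit Arguments.
Unset Strict Implicit.
Unset Printing Implicit Defensive.

Import Order.TTheory GRing.Theory Num.Theory.
Local Open Scope ring_scope.

Definition kronsum (R : realType) (p q : nat) (T : 'M[R]_p) (P : 'M[R]_q) :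
    'M[R]_(p * q) :=
  T *t (1%:M : 'M[R]_q) + (1%:M : 'M[R]_p) *t P.

Definition posdefmx (R : realType) (n : nat) (A : 'M[R]_n) : Prop :=
  A \is symmetricmx /\
  forall x : 'cV[R]_n, x != 0 -> 0 < (x^T *m A *m x) 0 0.

Definition onehot (R : realType) (a : nat) (i : 'I_a) : 'cV[R]_a :=
  delta_mx i 0.

(* [_ *t onehot _ _] has [p * 1] columns, and [onehot _ _ *t _] has [1 * q];
   neither is convertible to the intended width, hence the casts. *)
Definition id_tens_onehot (R : realType) (p q : nat) (i : 'I_q) :
    'M[R]_(p * q, p) :=
  castmx (erefl, muln1 p) ((1%:M : 'M[R]_p) *t onehot R i).

Definition onehot_tens_id (R : realType) (p q : nat) (j : 'I_p) :
    'M[R]_(p * q, q) :=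
  castmx (erefl, mul1n q) (onehot R j *t (1%:M : 'M[R]_q)).

Definition diag_part (R : realType) (n : nat) (A : 'M[R]_n) : 'M[R]_n :=
  diag_mx (\row_i A i i).

(* Since [x / 0 = 0] in MathComp, [\tr TP.1 != 0] is what makes the last
   condition a genuine statement about a ratio. *)
Definition kronsum_decomposition (R : realType) (p q : nat)
    (Omega : 'M[R]_(p * q)) (rho : R) (TP : 'M[R]_p * 'M[R]_q) : Prop :=
  [/\ TP.1 \is symmetricmx, TP.2 \is symmetricmx,
      kronsum TP.1 TP.2 = Omega,
      \tr TP.1 != 0
    & \tr TP.2 / \tr TP.1 = rho].

(* Main.v *)
(* The partial traces of T (+) P are q T + tr(P) I and p P + tr(T) I, so T and P
   can be read off the Kronecker sum once tr(T) and tr(P) are known. These follow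
   from tr(T (+) P) = q tr(T) + p tr(P) = (q + rho p) tr(T), where positive
   definiteness is used only to ensure that this trace, hence q + rho p, is
   nonzero. *)
Require Import Defs.
From mathcomp Require Import all_boot all_order all_algebra.
From mathcomp Require Import sesquilinear reals mxtens.
From mathcomp Require Import ring.

Set Implicit Arguments.
Unset Strict Implicit.
Unset Printing Implicit Defensive.

Import Order.TTheory GRing.Theory Num.Theory.
Local Open Scope ring_scope.

Lemma mxtrace_tens (R : comPzRingType) (m n : nat) (A : 'M[R]_m)
    (B : 'M[R]_n) : \tr (A *t B) = \tr A * \tr B.
Proof. by rewrite /mxtrace mulr_sum; apply: eq_bigr => i _; rewrite mxE. Qed.

Lemma posdefmx_diag_gt0 (R : realType) (n : nat) (A : 'M[R]_n) (i : 'I_n) :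
  posdefmx A -> 0 < A i i.
Proof.
case=> _ /(_ (delta_mx i 0)); rewrite trmx_delta -rowE -colE !mxE; apply.
by apply/eqP => /matrixP/(_ i 0)/eqP; rewrite !mxE !eqxx oner_eq0.
Qed.

(** Diagonal entries are values of the quadratic form at basis vectors, hence positive; [0 < n]
    supplies one entry to split off, which makes the sum strictly positive. *)
Lemma posdefmx_mxtrace_neq0 (R : realType) (n : nat) (A : 'M[R]_n) :
  (0 < n)%N -> posdefmx A -> \tr A != 0.
Proof.
case: n A => // n A _ A_pd; apply: lt0r_neq0; rewrite /mxtrace big_ord_recl.
apply: ltr_pwDl; first exact: posdefmx_diag_gt0.
by apply: sumr_ge0 => i _; apply/ltW/posdefmx_diag_gt0.
Qed.

Section PartialTraces.

Variables (R : realType) (p q : nat).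
Implicit Types (T : 'M[R]_p) (P : 'M[R]_q) (M : 'M[R]_(p * q)).

Definition ptrace_right M : 'M[R]_p :=
  \sum_(i < q) (id_tens_onehot R p i)^T *m M *m id_tens_onehot R p i.

Definition ptrace_left M : 'M[R]_q :=
  \sum_(j < p) (onehot_tens_id R q j)^T *m M *m onehot_tens_id R q j.

Lemma onehot_conj n (A : 'M[R]_n) (i : 'I_n) :
  (onehot R i)^T *m A *m onehot R i = (A i i)%:M.
Proof.
by rewrite /onehot trmx_delta -rowE -colE [LHS]mx11_scalar !mxE.
Qed.

(** By the mixed-product rule the conjugation acts on each tensor factor separately: the identity
    keeps [T], and the one-hot vector reduces [P] to a 1 x 1 block. *)
Lemma id_tens_onehot_conj T P (i : 'I_q) :
  (id_tens_onehot R p i)^T *m (T *t P) *m id_tens_onehot R p i = P i i *: T.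
Proof.
(* The trivial cast around [T *t P] makes every factor a cast, so that [castmx_mul] can be used
   backwards to move all casts outside the product. *)
rewrite /id_tens_onehot trmx_cast /= -[T *t P in LHS](castmx_id (erefl, erefl)).
rewrite -!castmx_mul trmx_tens !tensmx_mul onehot_conj trmx1 mul1mx mulmx1.
by rewrite tens_mx_scalar castmx_comp castmx_id.
Qed.

Lemma onehot_tens_id_conj T P (j : 'I_p) :
  (onehot_tens_id R q j)^T *m (T *t P) *m onehot_tens_id R q j = T j j *: P.
Proof.
rewrite /onehot_tens_id trmx_cast /= -[T *t P in LHS](castmx_id (erefl, erefl)).
rewrite -!castmx_mul trmx_tens !tensmx_mul onehot_conj trmx1 mul1mx mulmx1.
by rewrite tens_scalar_mx castmx_comp castmx_id.
Qed.

Lemma ptrace_right_kronsum T P :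
  ptrace_right (kronsum T P) = q%:R *: T + (\tr P)%:M.
Proof.
rewrite /ptrace_right /kronsum.
under eq_bigr do rewrite mulmxDr mulmxDl !id_tens_onehot_conj.
by rewrite big_split /= -!scaler_suml -/(\tr P) -/(\tr 1%:M) mxtrace1 scalemx1.
Qed.

Lemma ptrace_left_kronsum T P :
  ptrace_left (kronsum T P) = (\tr T)%:M + p%:R *: P.
Proof.
rewrite /ptrace_left /kronsum.
under eq_bigr do rewrite mulmxDr mulmxDl !onehot_tens_id_conj.
by rewrite big_split /= -!scaler_suml -/(\tr T) -/(\tr 1%:M) mxtrace1 scalemx1.
Qed.

Lemma mxtrace_kronsum T P :
  \tr (kronsum T P) = \tr T * q%:R + p%:R * \tr P.
Proof. by rewrite mxtraceD !mxtrace_tens !mxtrace1. Qed.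

(** The right-hand sides depend only on [M] and [rho], so this yields both uniqueness and, after
    taking diagonals, the two identification formulas. *)
Lemma kronsum_decomposition_inv M (rho : R) T P :
    (0 < p)%N -> (0 < q)%N -> \tr M != 0 ->
    kronsum_decomposition M rho (T, P) ->
  T = q%:R^-1 *: (ptrace_right M
        - (rho / (q%:R + rho * p%:R) * \tr M) *: 1%:M) /\
  P = p%:R^-1 *: (ptrace_left M
        - (1 / (q%:R + rho * p%:R) * \tr M) *: 1%:M).
Proof.
move=> p_gt0 q_gt0 trM_neq0 [/= _ _ M_def trT_neq0 rho_def].
have p_neq0 : p%:R != 0 :> R by rewrite pnatr_eq0 -lt0n.
have q_neq0 : q%:R != 0 :> R by rewrite pnatr_eq0 -lt0n.
have trP : \tr P = rho * \tr T by rewrite -rho_def divfK.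
have trM : \tr M = (q%:R + rho * p%:R) * \tr T.
  by rewrite -M_def mxtrace_kronsum trP; ring.
have den_neq0 : q%:R + rho * p%:R != 0.
  by apply: contraNneq trM_neq0 => den0; rewrite trM den0 mul0r.
(* The two correction terms are exactly the traces that the partial traces add as multiples of the
   identity. *)
have -> : 1 / (q%:R + rho * p%:R) * \tr M = \tr T.
  by rewrite trM div1r mulKf.
have -> : rho / (q%:R + rho * p%:R) * \tr M = \tr P.
  by rewrite trM mulrA divfK.
rewrite !scalemx1 -M_def ptrace_right_kronsum ptrace_left_kronsum.
by rewrite addrK addrC addKr !scalerA !mulVf // !scale1r.
Qed.

End PartialTraces.

(** Taking diagonals is linear and fixes the identity, so the formulas for whole matrices pass to
    their diagonals. *)
Lemma diag_part_affine (R : realType) (n : nat) (M : 'M[R]_n) (a c : R) :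
  diag_part (a *: (M - c *: 1%:M)) = a *: (diag_part M - c *: 1%:M).
Proof.
apply/matrixP => i j; rewrite !mxE eqxx.
by case: eqP => _; rewrite ?mulr1n ?mulr0n // mulr0 subr0 mulr0.
Qed.

Theorem theorem1 (R : realType) (p q : nat) (p_ge1 : (1 <= p)%N)
    (q_ge1 : (1 <= q)%N) (Theta : 'M[R]_p) (Psi : 'M[R]_q)
    (Omega : 'M[R]_(p * q)) (rho : R)
    (Theta_sym : Theta \is symmetricmx) (Psi_sym : Psi \is symmetricmx)
    (Omega_def : Omega = kronsum Theta Psi) (Omega_pd : posdefmx Omega)
    (trTheta_neq0 : \tr Theta != 0) (rho_def : rho = \tr Psi / \tr Theta) :
  [/\ unique (kronsum_decomposition Omega rho) (Theta, Psi),
      diag_part Theta =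
        q%:R^-1 *: (diag_part (\sum_(i < q)
                      (id_tens_onehot R p i)^T *m Omega *m id_tens_onehot R p i)
                    - (rho / (q%:R + rho * p%:R) * \tr Omega) *: 1%:M)
    & diag_part Psi =
        p%:R^-1 *: (diag_part (\sum_(j < p)
                      (onehot_tens_id R q j)^T *m Omega *m onehot_tens_id R q j)
                    - (1 / (q%:R + rho * p%:R) * \tr Omega) *: 1%:M)].
Proof.
have trOmega_neq0 : \tr Omega != 0.
  by apply: posdefmx_mxtrace_neq0 Omega_pd; rewrite muln_gt0 p_ge1 q_ge1.
have ThetaPsi_dec : kronsum_decomposition Omega rho (Theta, Psi) by split.
have inv T P := @kronsum_decomposition_inv R p q Omega rho T P
  p_ge1 q_ge1 trOmega_neq0.
have [ThetaE PsiE] := inv _ _ ThetaPsi_dec.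
split.
(* A competing pair is given by the same expressions in [Omega] and [rho] as [(Theta, Psi)]. *)
- split=> // -[T P] /inv[-> ->]; congr (_, _); [exact: ThetaE | exact: PsiE].
- by rewrite {1}ThetaE diag_part_affine.
- by rewrite {1}PsiE diag_part_affine.
Qed.
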